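(* Let $p$ be a prime, let $c$ be a nonnegative integer, let $U$ be a uniform pro-$p$ group, and let $G$ be a (not necessarily closed) subgroup of $U$. If $G$ has a subgroup of finite index which is nilpotent of class at most $c$, then $G$ is nilpotent of class at most $c$.
   Context: A pro-$p$ group $U$ is powerful if $U/\overline{U^p}$ is abelian (for $p$ odd), respectively $U/\overline{U^4}$ is abelian (for $p=2$), where $\overline{U^k}$ is the closure of the subgroup generated by $k$-th powers. A pro-$p$ group $U$ is uniform if it is topologically finitely generated, powerful, and $|P_i(U):P_{i+1}(U)| = |U:P_2(U)|$ for all $i \ge 1$, where $P_1(U)=U$ and $P_{i+1}(U)=\overline{P_i(U)^p[P_i(U),U]}$. (Equivalently: $U$ is topologically finitely generated, powerful and torsion free.) *)

(* Defs.v *)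
From HB Require Import structures.
From mathcomp Require Import all_boot.
From mathcomp Require Import boolp classical_sets functions cardinality.
From mathcomp Require Import topology.

Set Implicit Arguments.
Unset Strict Implicit.
Unset Printing Implicit Defensive.

Local Open Scope classical_set_scope.
Local Open Scope group_scope.
Local Open Scope card_scope.

HB.mixin Record isTopologicalGroup G & Group G & Topological G := {
  mulg_continuous : continuous (fun xy : G * G => xy.1 * xy.2) ;
  invg_continuous : continuous (fun x : G => x^-1)
}.

#[short(type="topologicalGroupType")]
HB.structure Definition TopologicalGroup :=
  {G of isTopologicalGroup G & Group G & Topological G}.

Section AbstractGroup.
Variable G : groupType.
Implicit Types (x y : G) (A B H K N : set G).

Definition is_subgroup H := group_closed (mem H).

Definition is_normal N := forall x y, N x -> N (x ^ y).

Definition generated A : set G := smallest is_subgroup A.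

Definition left_coset x H : set G := [set x * h | h in H].

(* The index |K : H| is the cardinality of this set. *)
Definition left_cosets K H : set (set G) := [set left_coset x H | x in K].

Definition finite_index K H := finite_set (left_cosets K H).

Definition set_prod A B : set G := [set x * y | x in A & y in B].

Definition power_subgroup k A : set G := generated [set x ^+ k | x in A].

Definition commutator_subgroup A B : set G :=
  generated [set [~ x, y] | x in A & y in B].

(* For N normal, G / N is abelian: xN * yN is xyN. *)
Definition abelian_quotient N :=
  forall x y, left_coset (x * y) N = left_coset (y * x) N.

(* Numbered from 1, as usual: the first term is H itself. *)
Definition lower_central_series H i : set G :=
  iter i.-1 (fun A => commutator_subgroup A H) H.

Definition nilpotent_of_class_le c H :=
  lower_central_series H c.+1 = [set 1].

End AbstractGroup.

Section ProPGroup.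
Variables (p : nat) (U : topologicalGroupType).

Definition profinite_group :=
  [/\ compact [set: U], hausdorff_space U &
      forall V : set U, nbhs (1 : U) V ->
        exists H : set U, [/\ is_subgroup H, open H & H `<=` V]].

Definition pro_p_group :=
  profinite_group /\
  forall N : set U, is_subgroup N -> is_normal N -> open N ->
    exists k : nat, left_cosets [set: U] N #= `I_(p ^ k)%N.

Definition topologically_finitely_generated :=
  exists2 S : set U, finite_set S & closure (generated S) = [set: U].

Definition powerful :=
  abelian_quotient
    (closure (power_subgroup (if p == 2%N then 4 else p) [set: U])).

(* P_i(U) for i >= 1; the value at 0 is irrelevant. *)
Definition lower_p_series i : set U :=
  iter i.-1 (fun A => closure (set_prod (power_subgroup p A)
                                  (commutator_subgroup A [set: U]))) [set: U].

Definition uniform_pro_p_group :=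
  [/\ pro_p_group,
      topologically_finitely_generated,
      powerful &
      forall i : nat, (1 <= i)%N ->
        left_cosets (lower_p_series i) (lower_p_series i.+1)
          #= left_cosets [set: U] (lower_p_series 2)].

End ProPGroup.

(* Main.v *)
From HB Require Import structures.
From mathcomp Require Import all_boot all_fingroup all_solvable finmap.
From mathcomp Require Import boolp classical_sets functions cardinality.
From mathcomp Require Import topology.
Require Import Defs.

(* In a uniform group roots are unique: x ^+ n = y ^+ n with n > 0 implies x = y.
   For n prime to p this holds in every finite p-quotient. For n = p, the p-th power
   map induces homomorphisms between the layers P_i / P_(i+1) of the lower p-series;
   they are surjective by powerfulness, hence bijective because uniform layers have
   equal finite size, and x^-1 y then lies in every P_i.

   If roots are unique, an element commuting with a power of x commutes with x. So
   when a power of each element of G lies in H, the centre of H is central in G;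
   moreover roots are still unique in G modulo its centre, and induction on the
   class of H applies. *)

Set Implicit Arguments.
Unset Strict Implicit.
Unset Printing Implicit Defensive.

Local Open Scope group_scope.

(** * Chief factors of finite p-groups *)

(** Take [L] normal in [P] and of index p in [K]. Then [K / L] is normal of prime order in the
    nilpotent group [P / L], so it meets the centre nontrivially and is therefore central. This is
    one step of the descent of the lower p-series inside a finite p-quotient. *)
Lemma pgroup_chief_step (p : nat) (gT : finGroupType) (P K : {group gT}) :
  p.-group P -> K <| P -> K :!=: 1 ->
  exists L : {group gT}, [/\ L <| P, (#|L| < #|K|)%N,
    forall x, x \in K -> x ^+ p \in L &
    forall x y, x \in K -> y \in P -> [~ x, y] \in L].
Proof.
move=> pP nKP K1; have [sKP nPK] := andP nKP; have pK := pgroupS sKP pP.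
have [p_pr pdvK [m oK]] := pgroup_pdiv pK K1.
have [L [sLK nLP oL]] : exists L : {group gT},
    [/\ L \subset K, L <| P & #|L| = (p ^ m)%N].
  by apply: (normal_pgroup pP nKP); rewrite oK pfactorK.
have [sLP nPL] := andP nLP.
have nLK : L <| K := normalS sLK sKP nLP.
have oKL : #|K / L| = p.
  rewrite card_quotient ?normal_norm // -divgS // oK oL expnS mulnK //.
  by rewrite expn_gt0 prime_gt0.
have cKL : K / L \subset 'Z(P / L).
  apply: prime_meetG; first by rewrite oKL.
  apply: meet_center_nil; first exact/quotient_nil/(pgroup_nil pP).
    exact: quotient_normal.
  by rewrite -cardG_gt1 oKL prime_gt1.
exists L; split=> // [|x Kx|x y Kx Py].
- by rewrite oL oK ltn_exp2l ?prime_gt1.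
- have Nx := fintype.subsetP (normal_norm nLK) x Kx.
  apply: coset_idr; first exact: groupX.
  rewrite morphX // -oKL; apply: expg_cardG.
  exact: mem_quotient.
- have : [~: K, P] \subset L.
    rewrite -quotient_cents2 ?normal_norm //.
    exact: fintype.subset_trans cKL (subsetIr _ _).
  by move/fintype.subsetP; apply; apply: mem_commg.
Qed.

Local Open Scope classical_set_scope.
Local Open Scope card_scope.

Local Notation "{ 'hom' G -> Q }" := (UMagmaMorphism.type G Q)
  (at level 0, G at level 98, Q at level 99, format "{ 'hom'  G  ->  Q }").

(** * Subgroups and quotients of abstract groups *)

Section Subgroups.
Variable G : groupType.
Implicit Types (x y : G) (A B H K N : set G).

Lemma subgroup_intro H :
  H 1 -> (forall x y, H x -> H y -> H (x * y)) -> (forall x, H x -> H x^-1) ->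
  is_subgroup H.
Proof.
move=> H1 HM HV; split; first by rewrite inE.
by move=> x y; rewrite !inE => Hx Hy; apply: HM => //; apply: HV.
Qed.

Lemma subgroup1 H : is_subgroup H -> H 1.
Proof. by case; rewrite inE. Qed.

Lemma subgroupF H x y : is_subgroup H -> H x -> H y -> H (x * y^-1).
Proof. by case=> _ HF Hx Hy; have := HF x y; rewrite !inE; apply. Qed.

Lemma subgroupV H x : is_subgroup H -> H x -> H x^-1.
Proof.
by move=> sH Hx; rewrite -[x^-1]mul1g; apply: subgroupF (subgroup1 sH) Hx.
Qed.

Lemma subgroupM H x y : is_subgroup H -> H x -> H y -> H (x * y).
Proof.
by move=> sH Hx Hy; rewrite -[y]invgK; apply: subgroupF => //; apply: subgroupV.
Qed.

Lemma subgroupVE H x : is_subgroup H -> H x^-1 = H x.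
Proof.
move=> sH; apply/propext; split; last exact: subgroupV.
by move=> /(subgroupV sH); rewrite invgK.
Qed.

Lemma subgroupX H x n : is_subgroup H -> H x -> H (x ^+ n).
Proof.
move=> sH Hx; elim: n => [|n IH]; first exact: subgroup1.
by rewrite expgS; apply: subgroupM.
Qed.

Lemma subgroupT : is_subgroup [set: G].
Proof. exact: subgroup_intro. Qed.

Lemma subgroup_trivial : is_subgroup [set (1 : G)].
Proof.
apply: subgroup_intro => //= [x y -> ->|x ->]; [exact: mulg1 | exact: invg1].
Qed.

Lemma subgroup_set_prod A B :
  is_subgroup A -> is_subgroup B -> is_normal B -> is_subgroup (set_prod A B).
Proof.
move=> sA sB nB; apply: subgroup_intro.
- by exists 1; [exact: subgroup1 | exists 1; [exact: subgroup1 | rewrite mulg1]].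
- move=> _ _ [a Aa [b Bb <-]] [a' Aa' [b' Bb' <-]].
  exists (a * a'); first exact: subgroupM.
  exists (b ^ a' * b'); first by apply: subgroupM => //; apply: nB.
  by rewrite mulgA -(mulgA a) -conjgC !mulgA.
- move=> _ [a Aa [b Bb <-]].
  exists a^-1; first exact: subgroupV.
  exists (b^-1 ^ a^-1); first by apply: nB; apply: subgroupV.
  by rewrite invgM [RHS]conjgC.
Qed.

Lemma normal_set_prod A B : is_normal A -> is_normal B -> is_normal (set_prod A B).
Proof.
move=> nA nB _ y [a Aa [b Bb <-]].
exists (a ^ y); first exact: nA.
by exists (b ^ y); [exact: nB | rewrite conjMg].
Qed.

Lemma subgroup_generated A : is_subgroup (generated A).
Proof.
apply: subgroup_intro.
- by move=> H [sH _]; apply: subgroup1.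
- by move=> x y Ax Ay H HA; apply: subgroupM; [case: HA | exact: Ax | exact: Ay].
- by move=> x Ax H HA; apply: subgroupV; [case: HA | exact: Ax].
Qed.

Lemma generated_sub A H : is_subgroup H -> A `<=` H -> generated A `<=` H.
Proof. exact: smallest_sub. Qed.

Lemma sub_generated A : A `<=` generated A.
Proof. exact: sub_gen_smallest. Qed.

Lemma normal_generated A : is_normal A -> is_normal (generated A).
Proof.
move=> nA x y gx.
suff : generated A `<=` [set z | generated A (z ^ y)] by apply.
apply: generated_sub.
- have sA := subgroup_generated A; apply: subgroup_intro => /=.
  + by rewrite conj1g; apply: (subgroup1 sA).
  + by move=> u v Au Av; rewrite conjMg; apply: (subgroupM sA).
  + by move=> u Au; rewrite conjVg; apply: (subgroupV sA).
- by move=> z Az; exact: (@sub_generated A _ (nA _ _ Az)).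
Qed.

Lemma subgroup_lower_central_series H i :
  is_subgroup H -> is_subgroup (lower_central_series H i).
Proof. by case: i => [|[|i]] // _; apply: subgroup_generated. Qed.

Lemma left_coset_eq H x y : is_subgroup H ->
  left_coset x H = left_coset y H <-> H (x^-1 * y).
Proof.
move=> sH; split=> [xHyH|Hxy].
  have : left_coset x H y.
    by rewrite xHyH; exists 1; rewrite ?mulg1 //; apply: subgroup1.
  by case=> h Hh <-; rewrite mulKg.
rewrite eqEsubset; split=> _ [h Hh <-].
  exists ((x^-1 * y)^-1 * h); first by apply: subgroupM => //; apply: subgroupV.
  by rewrite invgM invgK !mulgA mulgV mul1g.
exists (x^-1 * y * h); first exact: subgroupM.
by rewrite !mulgA mulgV mul1g.
Qed.

(* The powers of x cannot lie in pairwise distinct cosets. *)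
Lemma finite_index_power H K x :
  is_subgroup H -> is_subgroup K -> finite_index K H -> K x ->
  exists2 n, (0 < n)%N & H (x ^+ n).
Proof.
move=> sH sK fKH Kx; pose f n := left_coset (x ^+ n) H.
have ninj : ~ injective f.
  move=> injf; apply: infinite_nat.
  have : finite_set (f @` [set: nat]).
    apply: sub_finite_set fKH => _ [n _ <-].
    by exists (x ^+ n) => //; apply: subgroupX.
  apply: card_le_finite.
  by have /card_eqPle[] := inj_card_eq (A := [set: nat]) (in2W injf).
have [m [n [fmn lt_mn]]] : exists m n, f m = f n /\ (m < n)%N.
  have /existsNP[m /existsNP[n /not_implyP[fmn /eqP]]] := ninj.
  by rewrite neq_ltn => /orP[] lt; [exists m, n | exists n, m].
exists (n - m)%N; first by rewrite subn_gt0.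
move/(left_coset_eq _ _ sH): fmn.
have -> : x ^+ n = x ^+ m * x ^+ (n - m) by rewrite -expgnDr subnKC // ltnW.
by rewrite mulKg.
Qed.

End Subgroups.

Section Quotient.
Variables (G : groupType) (N : set G).
Hypotheses (sN : is_subgroup N) (nN : is_normal N).

Let R (x y : G) : bool := `[< N (x^-1 * y) >].

Let R_equiv : equiv_class_of R.
Proof.
split.
- by move=> x; apply/asboolP; rewrite mulVg; apply: subgroup1.
- by move=> x y; apply: asbool_equiv_eq; rewrite -(subgroupVE _ sN) invgM invgK.
- move=> y x z /asboolP Nxy /asboolP Nyz; apply/asboolP.
  by rewrite -(mulgK y x^-1) -mulgA; apply: subgroupM.
Qed.

Let E := EquivRelPack R_equiv.
Let T : choiceType := {eq_quot E}%qT.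
Let pi (x : G) : T := (\pi x)%qT.
Let rep (u : T) : G := generic_quotient.repr u.

Let piP x y : pi x = pi y <-> N (x^-1 * y).
Proof.
split=> [xy|Nxy]; last by apply/eqmodP/asboolP.
by have /eqmodP/asboolP := xy.
Qed.

Let quo_mul (u v : T) : T := pi (rep u * rep v).
Let quo_inv (u : T) : T := pi (rep u)^-1.

Let pi_rep u : pi (rep u) = u. Proof. exact: reprK. Qed.

Let piM x y : quo_mul (pi x) (pi y) = pi (x * y).
Proof.
have /piP Nx := pi_rep (pi x); have /piP Ny := pi_rep (pi y).
apply/piP; rewrite invgM -mulgA (mulgA _ x).
rewrite [_ * y]conjgC mulgA; apply: subgroupM => //.
exact: nN.
Qed.

Let piV x : quo_inv (pi x) = pi x^-1.
Proof.
have /piP Nx := pi_rep (pi x); apply/piP; rewrite invgK.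
have := nN (rep (pi x))^-1 (subgroupV sN Nx).
by rewrite /conjg !invgM !invgK !mulgA mulgK.
Qed.

Let quo_mulA : associative quo_mul.
Proof.
by move=> u v w; rewrite -(pi_rep u) -(pi_rep v) -(pi_rep w) !piM mulgA.
Qed.

Let quo_mul1 : left_id (pi 1) quo_mul.
Proof. by move=> u; rewrite -(pi_rep u) piM mul1g. Qed.

Let quo_1mul : right_id (pi 1) quo_mul.
Proof. by move=> u; rewrite -(pi_rep u) piM mulg1. Qed.

Let quo_mulV : left_inverse (pi 1) quo_inv quo_mul.
Proof. by move=> u; rewrite -(pi_rep u) piV piM mulVg. Qed.

Let quo_Vmul : right_inverse (pi 1) quo_inv quo_mul.
Proof. by move=> u; rewrite -(pi_rep u) piV piM mulgV. Qed.

(** Only a surjection with kernel [N] is exported: congruences modulo [N] become equations in a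
    genuine group, where commutator identities can be rewritten. *)
Lemma quotient_group : exists (Q : groupType) (f : {hom G -> Q}),
  (forall u, exists x, f x = u) /\ (forall x, f x = 1 <-> N x).
Proof.
pose Q : groupType := HB.pack_for groupType (Choice.sort T)
  (isGroup.Build T quo_mulA quo_mul1 quo_1mul quo_mulV quo_Vmul).
have fF : {morph (pi : G -> Q) : x y / x * y^-1}.
  by move=> x y; rewrite -[RHS]/(quo_mul (pi x) (quo_inv (pi y))) piV piM.
pose f : {hom G -> Q} := HB.pack_for {hom G -> Q} (pi : G -> Q)
  (isGroupMorphism.Build G Q pi fF).
exists Q, f; split=> [u|x]; first by exists (rep u); apply: pi_rep.
split=> [fx1|Nx]; last by apply/esym/piP; rewrite invg1 mul1g.
have /esym/piP : pi x = pi 1 by [].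
by rewrite invg1 mul1g.
Qed.

End Quotient.

(** Lets a subgroup be treated as an ambient group, so that the nilpotency induction can be stated
    for whole groups only. *)
Lemma subgroup_group (G : groupType) (H : set G) : is_subgroup H ->
  exists (S : groupType) (f : {hom S -> G}), injective f /\ range f = H.
Proof.
move=> sH; pose T := {x : G | x \in H}.
pose M := SubChoice_isSubGroup.Build G (mem H) T sH.
pose S : subGroupType (mem H) := HB.pack_for (SubGroup.type (mem H)) T M.
exists S, (val : S -> G); split; first exact: val_inj.
rewrite eqEsubset; split=> [_ [x _ <-]|x Hx]; first exact/set_mem/(valP x).
by exists (Sub x (mem_set Hx)) => //; rewrite SubK.
Qed.

Section Images.
Variables (G Q : groupType) (f : {hom G -> Q}).
Implicit Types A B H : set G.

Lemma subgroup_image H : is_subgroup H -> is_subgroup (f @` H).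
Proof.
move=> sH; apply: subgroup_intro.
- by exists 1; [exact: subgroup1 | rewrite gmulf1].
- move=> _ _ [x Hx <-] [y Hy <-].
  by exists (x * y); [exact: subgroupM | rewrite gmulfM].
- by move=> _ [x Hx <-]; exists x^-1; [exact: subgroupV | rewrite gmulfV].
Qed.

Lemma subgroup_preimage (K : set Q) : is_subgroup K -> is_subgroup (f @^-1` K).
Proof.
move=> sK; apply: subgroup_intro => [|x y Kx Ky|x Kx] /=.
- by rewrite gmulf1; apply: subgroup1.
- by rewrite gmulfM; apply: subgroupM.
- by rewrite gmulfV; apply: subgroupV.
Qed.

Lemma image_generated A : f @` generated A = generated (f @` A).
Proof.
rewrite eqEsubset; split.
- suff sub : generated A `<=` f @^-1` generated (f @` A).
    by move=> _ [x Ax <-]; apply: (sub x Ax).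
  apply: generated_sub; first exact/subgroup_preimage/subgroup_generated.
  by move=> x Ax; apply: (@sub_generated _ (f @` A)); exists x.
- apply: generated_sub; first exact/subgroup_image/subgroup_generated.
  by apply: image_subset => x Ax; apply: (@sub_generated _ A).
Qed.

Lemma image_commutator A B :
  f @` commutator_subgroup A B = commutator_subgroup (f @` A) (f @` B).
Proof.
rewrite image_generated; congr generated; rewrite eqEsubset; split.
- move=> _ [_ [a Aa [b Bb <-]] <-].
  by exists (f a); [exists a | exists (f b); [exists b | rewrite gmulfR]].
- move=> _ [_ [a Aa <-] [_ [b Bb <-] <-]].
  by exists [~ a, b]; [exists a => //; exists b | rewrite gmulfR].
Qed.

Lemma image_lower_central_series H i :
  f @` lower_central_series H i = lower_central_series (f @` H) i.
Proof.
case: i => [|i] //; rewrite /lower_central_series /=.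
by elim: i => //= i IH; rewrite image_commutator IH.
Qed.

Lemma image_nilpotent H c : injective f ->
  nilpotent_of_class_le c (f @` H) <-> nilpotent_of_class_le c H.
Proof.
rewrite /nilpotent_of_class_le => injf; rewrite -image_lower_central_series.
have f1 : [set (1 : Q)] = f @` [set 1] by rewrite image_set1 gmulf1.
rewrite f1; split=> [fH|-> //].
by apply/funext => x; rewrite -(image_inj injf) fH (image_inj injf).
Qed.

End Images.

(** Collection: moving a [z] to the right past a [y] costs one factor [[~ z, y]], which commutes
    with everything in sight, and gathering all the [y] on the left takes 0 + 1 + ... + (n - 1) such
    moves. *)
Lemma expgMn_class2 (G : groupType) (y z : G) n :
  commute y [~ z, y] -> commute z [~ z, y] ->
  (y * z) ^+ n = y ^+ n * z ^+ n * [~ z, y] ^+ 'C(n, 2).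
Proof.
move: (commgC z y); move: [~ z, y] => c zyc yc zc.
have zny m : z ^+ m * y = y * z ^+ m * c ^+ m.
  elim: m => [|m IH]; first by rewrite !expg0 mul1g !mulg1.
  rewrite expgS -mulgA IH !mulgA zyc -!mulgA; congr (_ * (_ * _)).
  rewrite expgS !mulgA; congr (_ * _).
  exact: commuteX (commute_sym zc).
elim: n => [|n IH]; first by rewrite !expg0 !mulg1.
rewrite expgSr IH binS bin1 addnC expgnDr -mulgA.
have cX m k : commute (c ^+ m) (z ^+ k) by apply: commute_sym; apply: commuteX2.
have -> : c ^+ 'C(n, 2) * (y * z) = y * z * c ^+ 'C(n, 2).
  by apply: commuteM; apply: commute_sym; apply: commuteX.
rewrite !expgSr !mulgA; congr (_ * _).
rewrite -(mulgA (y ^+ n)) zny !mulgA -!mulgA; congr (_ * (_ * (_ * _))).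
by have := cX n 1%N; rewrite expg1.
Qed.

(** * Groups with unique roots *)

Section UniqueRoots.

Definition unique_roots (G : groupType) :=
  forall n (x y : G), (0 < n)%N -> x ^+ n = y ^+ n -> x = y.

Variable G : groupType.
Hypothesis rootG : unique_roots G.

(** If [y] fixes [x ^+ n] under conjugation, then [x ^ y] and [x] are n-th roots of the same
    element. *)
Lemma unique_roots_commute n (x y : G) : (0 < n)%N ->
  commute (x ^+ n) y -> commute x y.
Proof.
move=> n0 /commgP; rewrite -conjg_fix => /eqP; rewrite conjXg => xny.
by apply/commgP; rewrite -conjg_fix; apply/eqP; apply: rootG xny.
Qed.

Definition center : set G := [set z | forall x, commute z x].

Lemma subgroup_center : is_subgroup center.
Proof.
apply: subgroup_intro => [x|y z Zy Zz x|z Zz x].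
- by rewrite /commute mul1g mulg1.
- by apply: commute_sym; apply: commuteM; apply: commute_sym.
- by apply: commute_sym; apply: commuteV; apply: commute_sym.
Qed.

Lemma normal_center : is_normal center.
Proof. by move=> z y Zz; rewrite conjgE Zz mulKg. Qed.

(** If [x ^+ n] and [y ^+ n] differ by a central element, then [x ^+ n] commutes with [y], hence so
    does [x]. The n-th power of [y^-1 * x] is then the product of the n-th powers, which is central,
    and an element with a central power is itself central. *)
Lemma unique_roots_mod_center (Q : groupType) (f : {hom G -> Q}) :
  (forall u, exists x, f x = u) -> (forall x, f x = 1 <-> center x) ->
  unique_roots Q.
Proof.
move=> fs fZ n u v n0; have [[x <-] [y <-]] := (fs u, fs v).
rewrite -!gmulfXn => fxy.
have Zxy : center ((y ^+ n)^-1 * x ^+ n).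
  by apply/fZ; rewrite gmulfM gmulfV fxy mulVg.
have cxy : commute x y.
  apply: (unique_roots_commute n0).
  rewrite -(mulVKg (y ^+ n) (x ^+ n)); apply: commute_sym; apply: commuteM.
    by apply: commuteX.
  exact/commute_sym/Zxy.
suff Z : center (y^-1 * x).
  by apply: (@mulgI _ (f y)^-1); rewrite mulVg -gmulfV -gmulfM; apply/fZ.
move=> z; apply: (unique_roots_commute n0).
rewrite expgMn ?expVgn; first exact: Zxy.
exact/commute_sym/commuteV.
Qed.

End UniqueRoots.

(* An element of H central in H commutes with a power of every element of G,
   hence is central in G: so passing to G modulo its centre lowers the class of H
   by one, and preserves uniqueness of roots. *)
Lemma nilpotent_of_finite_exponent_subgroup c :
  forall (G : groupType) (H : set G), unique_roots G -> is_subgroup H ->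
  (forall x, exists2 n, (0 < n)%N & H (x ^+ n)) ->
  nilpotent_of_class_le c H -> nilpotent_of_class_le c [set: G].
Proof.
elim: c => [|c IH] G H rootG sH powH nilH.
  (* Class 0 means that [H] is trivial: every element of [G] then has a power equal to 1, and 1 is
     the only root of 1. *)
  rewrite /nilpotent_of_class_le /lower_central_series /= in nilH *.
  rewrite eqEsubset; split=> x //= _; have [n n0] := powH x.
  rewrite nilH /= => xn1; apply: (rootG n) => //.
  by rewrite xn1 expg1n.
have [Q [f [fs fZ]]] := quotient_group (subgroup_center G) (@normal_center G).
have H1 (A : set G) x y :
    lower_central_series A c.+2 = [set 1] -> lower_central_series A c.+1 x ->
    A y -> commute x y.
  move=> A1 Ax Ay; apply/commgP/eqP.
  have : lower_central_series A c.+2 [~ x, y].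
    by apply: sub_generated; exists x => //; exists y.
  by rewrite A1.
have nilQ : nilpotent_of_class_le c [set: Q].
  apply: (IH Q (f @` H)) => [||u|].
  - exact: unique_roots_mod_center fs fZ.
  - exact: subgroup_image.
  - have [x <-] := fs u; have [n n0 Hxn] := powH x.
    by exists n => //; exists (x ^+ n); rewrite ?gmulfXn.
  - rewrite /nilpotent_of_class_le -image_lower_central_series.
    rewrite eqEsubset; split=> [_ [x Hx <-]|_ -> /=].
      apply/fZ => y; have [n n0 Hyn] := powH y.
      apply/commute_sym/(unique_roots_commute rootG n0)/commute_sym.
      exact: H1 nilH Hx Hyn.
    exists 1; last exact: gmulf1.
    exact: (subgroup1 (subgroup_lower_central_series c.+1 sH)).
have fT : f @` [set: G] = [set: Q].
  by rewrite eqEsubset; split=> // u _; have [x <-] := fs u; exists x.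
rewrite /nilpotent_of_class_le -fT -image_lower_central_series in nilQ.
rewrite /nilpotent_of_class_le eqEsubset; split; last first.
  move=> _ ->.
  exact: (subgroup1 (subgroup_lower_central_series c.+2 (subgroupT G))).
apply: generated_sub; first exact: subgroup_trivial.
(* By [nilQ], term c + 1 of the lower central series of [G] dies in [Q], so it is central and its
   commutators are trivial. *)
move=> _ [x Gx [y _ <-]] /=; apply/eqP/commgP.
suff /fZ : f x = 1 by [].
have : (f @` lower_central_series [set: G] c.+1) (f x) by exists x.
by rewrite nilQ.
Qed.

(** * Finite quotients and counting *)

(** The fibres of [f] are exactly the left cosets of [N]. *)
Lemma card_quotient_group (G Q : groupType) (f : {hom G -> Q}) (N : set G) :
  is_subgroup N ->
  (forall u, exists x, f x = u) -> (forall x, f x = 1 <-> N x) ->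
  [set: Q] #= left_cosets [set: G] N.
Proof.
move=> sN fs fN; pose h u := [set x | f x = u].
have hf x : h (f x) = left_coset x N.
  rewrite eqEsubset; split=> [y /= fyx|_ [z Nz <-]] /=.
    exists (x^-1 * y); last by rewrite mulVKg.
    by apply/fN; rewrite gmulfM gmulfV fyx mulVg.
  by rewrite /h /= gmulfM (iffRL (fN z) Nz) mulg1.
have injh : injective h.
  move=> u v; have [[x <-] [y <-]] := (fs u, fs v).
  by move=> hxy; have : h (f x) x by []; rewrite hxy.
have -> : left_cosets [set: G] N = h @` [set: Q].
  rewrite eqEsubset; split=> [_ [x _ <-]|_ [u _ <-]].
    by exists (f x).
  by have [x <-] := fs u; exists x.
exact/card_esym/(inj_card_eq (in2W injh)).
Qed.

(** The finite structure is pulled back along a bijection of the quotient with ['I_n], which gives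
    access to the theory of finite p-groups. *)
Lemma finite_quotient_group (G : groupType) (N : set G) n :
  is_subgroup N -> is_normal N -> left_cosets [set: G] N #= `I_n ->
  exists (Q : finGroupType) (f : {hom G -> Q}),
    (forall x, f x = 1 <-> N x) /\ #|Q| = n.
Proof.
move=> sN nN cN; have [Q0 [f [fs fN]]] := quotient_group sN nN.
have : [set: Q0] #= [set: 'I_n].
  apply: card_eq_trans card_II; apply: card_eq_trans cN.
  exact: card_quotient_group fs fN.
case/card_bijP => g0 g0_bij.
pose g (u : Q0) : 'I_n := val (g0 (to_setT u)).
have [h gK hK] : bijective g.
  have [h0 g0K h0K] := g0_bij.
  have to_setT_val T (a : [set: T]) : to_setT (val a) = a by apply: val_inj.
  by exists (fun i : 'I_n => val (h0 (to_setT i))) => u;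
    rewrite /g to_setT_val ?g0K ?h0K.
have ax : Finite.axiom [seq h i | i <- enum 'I_n].
  apply: Finite.uniq_enumP.
    by rewrite map_inj_uniq ?enum_uniq //; apply: can_inj hK.
  by move=> u; rewrite inE; apply/mapP; exists (g u); rewrite ?mem_enum // gK.
pose Q : finGroupType := HB.pack_for finGroupType Q0
  (CanIsCountable gK) (isFinite.Build Q0 ax).
exists Q, f; split=> //.
have -> : n = #|'I_n| by rewrite card_ord.
exact: (@bij_eq_card Q _ g (Bijective gK hK)).
Qed.

Lemma surj_card_eq_inj (T T' : choiceType) (A : set T) (B : set T') (g : T -> T') :
  finite_set A -> A #= B -> g @` A = B -> {in A &, injective g}.
Proof.
move=> fA; have [n An] := (finite_setP A).1 fA => AB gAB.
have cA := card_fset_set An.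
have cB := card_fset_set (card_eq_trans (card_esym AB) An).
move=> x y xA yA.
have /card_in_imfsetP inj : #|` (g @` fset_set A)%fset| == #|` fset_set A|.
  by rewrite -fset_set_image // gAB cA cB.
by apply: inj; rewrite in_fset_set.
Qed.

(** * Compact topological groups *)

Section TopologicalGroups.
Variable U : topologicalGroupType.
Implicit Types (x y : U) (A B H K N : set U).

Lemma continuous_mulg (T : topologicalType) (f g : T -> U) :
  continuous f -> continuous g -> continuous (fun t => f t * g t).
Proof.
move=> cf cg t.
apply: (@cvg_comp _ _ _ (fun t => (f t, g t)) (fun xy : U * U => xy.1 * xy.2)).
  exact: cvg_pair (cf t) (cg t).
exact: (mulg_continuous (f t, g t)).
Qed.

Lemma continuous_invg (T : topologicalType) (f : T -> U) :
  continuous f -> continuous (fun t => (f t)^-1).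
Proof. by move=> cf t; apply: cvg_comp (cf t) (invg_continuous _). Qed.

Lemma continuous_conjg (T : topologicalType) (f g : T -> U) :
  continuous f -> continuous g -> continuous (fun t => f t ^ g t).
Proof.
move=> cf cg; apply: continuous_mulg; first exact: continuous_invg.
exact: continuous_mulg.
Qed.

Lemma continuous_commg (T : topologicalType) (f g : T -> U) :
  continuous f -> continuous g -> continuous (fun t => [~ f t, g t]).
Proof.
move=> cf cg; apply: continuous_mulg; first exact: continuous_invg.
exact: continuous_conjg.
Qed.

Lemma continuous_expg (T : topologicalType) (f : T -> U) n :
  continuous f -> continuous (fun t => f t ^+ n).
Proof.
move=> cf; elim: n => [|n IH]; first exact: cst_continuous.
under eq_fun do rewrite expgS.
exact: continuous_mulg.
Qed.

Let cid : continuous (fun x : U => x). Proof. by move=> x; apply: cvg_id. Qed.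
Let ccst y : continuous (fun _ : U => y). Proof. exact: cst_continuous. Qed.

Lemma closure_min A B : closed B -> A `<=` B -> closure A `<=` B.
Proof. by move=> /closure_id cB AB; rewrite cB; apply: closureS. Qed.

Lemma closed_preimage (f : U -> U) A :
  continuous f -> closed A -> closed (f @^-1` A).
Proof. by move=> /continuous_closedP; apply. Qed.

Lemma closure_preimage (f : U -> U) A B :
  continuous f -> closed B -> A `<=` f @^-1` B -> closure A `<=` f @^-1` B.
Proof. by move=> cf cB; apply: closure_min; apply: closed_preimage. Qed.

Lemma subgroup_closure A : is_subgroup A -> is_subgroup (closure A).
Proof.
move=> sA; have cA : closed (closure A) by apply: closed_closure.
have sub := @subset_closure U A.
apply: subgroup_intro.
- exact: (sub _ (subgroup1 sA)).
- move=> x y Ax Ay.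
  have Axz z : A z -> closure A (x * z).
    move=> Az; apply: (@closure_preimage ( *%g^~ z) A (closure A)) Ax => //.
      exact: continuous_mulg.
    by move=> t At; exact: (sub _ (subgroupM sA _ _)).
  apply: (@closure_preimage ( *%g x) A (closure A)) Ay => //.
  exact: continuous_mulg.
- move=> x Ax; apply: (@closure_preimage (fun z : U => z^-1) A (closure A)) Ax => //.
    exact: continuous_invg.
  by move=> t At; exact: (sub _ (subgroupV sA _)).
Qed.

Lemma normal_closure A : is_normal A -> is_normal (closure A).
Proof.
move=> nA x y Ax.
apply: (@closure_preimage (fun z => z ^ y) A (closure A)) Ax => //.
- exact: continuous_conjg.
- exact: closed_closure.
- by move=> z Az; apply/subset_closure/nA.
Qed.

Lemma compact_set_prod A B : compact A -> compact B -> compact (set_prod A B).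
Proof.
move=> cA cB.
have -> : set_prod A B = (fun xy : U * U => xy.1 * xy.2) @` (A `*` B).
  rewrite eqEsubset; split=> [_ [a Aa [b Bb <-]]|_ [[a b] [Aa Bb] <-]].
    by exists (a, b).
  by exists a => //; exists b.
apply: continuous_compact; last exact: compact_setX.
exact/continuous_subspaceT/mulg_continuous.
Qed.

Lemma open_subgroup_closed H : is_subgroup H -> open H -> closed H.
Proof.
move=> sH oH; rewrite -openC openE => x nHx /=.
have : (fun y : U => x^-1 * y) @^-1` H `<=` ~` H.
  move=> y Hxy Hy; apply: nHx.
  rewrite -[x]invgK -[x^-1](mulgK y) invgM invgK; apply: subgroupM => //.
  exact: subgroupV.
move/filterS; apply.
apply: (continuous_mulg (@ccst x^-1) cid); rewrite mulVg.
by apply: open_nbhs_nbhs; split=> //; apply: subgroup1.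
Qed.

Lemma subgroup_nbhs_open H : is_subgroup H -> nbhs 1 H -> open H.
Proof.
move=> sH nH; rewrite openE => x Hx /=.
have : (fun y : U => x^-1 * y) @^-1` H `<=` H.
  by move=> y Hxy; rewrite -[y](mulVKg x); apply: subgroupM.
move/filterS; apply.
by apply: (continuous_mulg (@ccst x^-1) cid); rewrite mulVg.
Qed.

(* By compactness, conjugates x ^ y with x close to 1 are close to 1 uniformly
   in y. *)
Lemma open_normal_core H : compact [set: U] -> is_subgroup H -> open H ->
  exists N, [/\ is_subgroup N, is_normal N, open N & N `<=` H].
Proof.
move=> cU sH oH; pose N := [set x | forall y, H (x ^ y)].
have sN : is_subgroup N.
  apply: subgroup_intro => [y|x z Nx Nz y|x Nx y].
  - by rewrite conj1g; apply: subgroup1.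
  - by rewrite conjMg; apply: subgroupM.
  - by rewrite conjVg; apply: subgroupV.
exists N; split=> //.
- by move=> x y Nx z; rewrite -conjgM.
- apply: subgroup_nbhs_open => //.
  have cov := (compact_near_coveringP [set: U]).1 cU.
  have : \forall x \near nbhs (1 : U), [set: U] `<=` (fun y => H (x ^ y)).
    apply: cov => y _.
    have cc : continuous (fun yx : U * U => yx.2 ^ yx.1).
      by apply: continuous_conjg => -[a b]; [exact: cvg_snd | exact: cvg_fst].
    apply: (cc (y, 1)) => /=; rewrite conj1g.
    by apply: open_nbhs_nbhs; split=> //; apply: subgroup1.
  by apply: filterS => x Hx y; apply: Hx.
- by move=> x Nx; rewrite -[x]conjg1; apply: Nx.
Qed.

End TopologicalGroups.

(** * The lower p-series *)

Section LowerPSeries.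
Variables (p : nat) (U : topologicalGroupType).
Local Notation P := (@lower_p_series p U).
Implicit Types x y z : U.

(** The series is numbered from 1, hence the index [i.+1] here and below. Normality comes first,
    because the product of the two generated subgroups is a subgroup only thanks to the normality of
    a factor. *)
Lemma lower_p_seriesP i :
  [/\ is_subgroup (P i.+1), is_normal (P i.+1) & closed (P i.+1)].
Proof.
case: i => [|i].
  by split; [exact: subgroupT | by [] | exact: closedT].
have nP : is_normal (P i.+1).
  elim: i => [|i IH] // ; apply/normal_closure/normal_set_prod.
    apply: normal_generated => _ y [x Px <-].
    by exists (x ^ y); [exact: IH | rewrite conjXg].
  apply: normal_generated => _ y [x Px [z _ <-]].
  by exists (x ^ y); [exact: IH | exists (z ^ y); rewrite ?conjRg].
have nC : is_normal (commutator_subgroup (P i.+1) [set: U]).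
  apply: normal_generated => _ y [x Px [z _ <-]].
  by exists (x ^ y); [exact: nP | exists (z ^ y); rewrite ?conjRg].
split; last exact: closed_closure.
  apply/subgroup_closure/subgroup_set_prod => //; exact: subgroup_generated.
apply/normal_closure/normal_set_prod => //.
apply: normal_generated => _ y [x Px <-].
by exists (x ^ y); [exact: nP | rewrite conjXg].
Qed.

Lemma lower_p_series_subgroup i : is_subgroup (P i.+1).
Proof. by case: (lower_p_seriesP i). Qed.
Hint Resolve lower_p_series_subgroup : core.

Lemma lower_p_series_normal i : is_normal (P i.+1).
Proof. by case: (lower_p_seriesP i). Qed.

Lemma lower_p_series_closed i : closed (P i.+1).
Proof. by case: (lower_p_seriesP i). Qed.

Lemma lower_p_series_expg i x : P i.+1 x -> P i.+2 (x ^+ p).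
Proof.
move=> Px; apply: subset_closure; exists (x ^+ p).
  by apply: sub_generated; exists x.
by exists 1; [exact: subgroup1 (subgroup_generated _) | rewrite mulg1].
Qed.

Lemma lower_p_series_commg i x y : P i.+1 x -> P i.+2 [~ x, y].
Proof.
move=> Px; apply: subset_closure; exists 1.
  exact: subgroup1 (subgroup_generated _).
exists [~ x, y]; last by rewrite mul1g.
by apply: sub_generated; exists x => //; exists y.
Qed.

(** The universal property through which later inclusions of terms of the series are proved: only
    p-th powers and commutators have to be checked. *)
Lemma lower_p_series_min i (K : set U) : is_subgroup K -> closed K ->
  (forall x, P i.+1 x -> K (x ^+ p)) -> (forall x y, P i.+1 x -> K [~ x, y]) ->
  P i.+2 `<=` K.
Proof.
move=> sK cK KX KR; apply: closure_min => // _ [x + [y + <-]].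
move=> Kx Ky; apply: subgroupM => //; [move: Kx | move: Ky]; apply: generated_sub => //.
  by move=> _ [z Pz <-]; apply: KX.
by move=> _ [z Pz [t _ <-]]; apply: KR.
Qed.

Lemma lower_p_series_sub i x : P i.+2 x -> P i.+1 x.
Proof.
have [sP nP cP] := lower_p_seriesP i.
apply: lower_p_series_min => // y z; first exact: subgroupX.
by move=> Py; rewrite commgEl; apply: (subgroupM sP); [exact: subgroupV | exact: nP].
Qed.

Lemma lower_p_series_quotient i : exists (Q : groupType) (f : {hom U -> Q}),
  (forall u, exists x, f x = u) /\ (forall x, f x = 1 <-> P i.+1 x).
Proof. exact: quotient_group (@lower_p_series_normal i). Qed.

Hypothesis p_pr : prime p.
Hypothesis U_powerful : powerful p U.

Lemma powerful_commg x y :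
  closure (power_subgroup (if p == 2%N then 4 else p) [set: U]) [~ x, y].
Proof.
have sN := subgroup_closure (subgroup_generated
  [set z ^+ (if p == 2%N then 4 else p) | z in [set: U]]).
have /(left_coset_eq _ _ sN) := U_powerful y x.
by rewrite invgM commgEl conjgE !mulgA.
Qed.

(** For a normal subgroup [M], this is the preimage of the centre of the quotient by [M]. When [M]
    is also closed it is a closed subgroup, so [lower_p_series_min] applies to it. *)
Let central_mod (M : set U) := [set x | forall y, M [~ x, y]].

Let central_mod_closed (M : set U) : closed M -> closed (central_mod M).
Proof.
move=> cM; have -> : central_mod M = \bigcap_(y in [set: U]) (commg^~ y @^-1` M).
  by rewrite eqEsubset; split=> x Mx y; [move=> _; apply: Mx | apply: Mx].
apply: closed_bigI => y _; apply: closed_preimage => //.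
apply: continuous_commg; first by move=> x; apply: cvg_id.
exact: cst_continuous.
Qed.

Let central_mod_subgroup (M : set U) :
  is_subgroup M -> is_normal M -> is_subgroup (central_mod M).
Proof.
move=> sM nM; have [Q [f [fs fM]]] := quotient_group sM nM.
have -> : central_mod M = f @^-1` @center Q.
  rewrite eqEsubset; split=> x /= Mx y.
    have [z <-] := fs y; apply/commgP/eqP; rewrite -gmulfR; exact/fM/Mx.
  by apply/fM; rewrite gmulfR; apply/eqP/commgP/Mx.
exact/subgroup_preimage/subgroup_center.
Qed.

Lemma commXg_commute (G : groupType) (a b : G) n :
  commute a [~ a, b] -> [~ a ^+ n, b] = [~ a, b] ^+ n.
Proof.
move=> ab; rewrite commgEl conjXg.
have -> : a ^ b = a * [~ a, b] by rewrite commgEl mulVKg.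
by rewrite expgMn // mulKg.
Qed.

(** For p = 2, commutators drop two layers instead of one. At the first layer they lie in the
    closure of the subgroup generated by fourth powers, that is, squares of squares. Further down,
    [[~ z, t]] is central modulo [P i.+4], so there [[~ z ^+ 2, t]] equals [[~ z, t] ^+ 2], which is
    trivial. *)
Lemma lower_2_series_commg i x y : p = 2%N -> P i.+1 x -> P i.+3 [~ x, y].
Proof.
move=> p2; elim: i x y => [|i IH] x y Px.
  have sub : closure (power_subgroup 4 [set: U]) `<=` P 3.
    apply: closure_min; first exact: lower_p_series_closed.
    apply: generated_sub => // _ [z _ <-].
    have <- : z ^+ p ^+ p = z ^+ 4 by rewrite -expgnA p2.
    by do 2!apply: lower_p_series_expg.
  by apply: sub; have := @powerful_commg x y; rewrite p2.
suff : P i.+2 `<=` central_mod (P i.+4) by apply.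
have [sP nP cP] := lower_p_seriesP i.+3.
apply: lower_p_series_min => [||z Pz t|z t Pz u].
- exact: central_mod_subgroup.
- exact: central_mod_closed.
- have [Q [f [_ fP]]] := lower_p_series_quotient i.+3.
  apply/fP; rewrite gmulfR gmulfXn commXg_commute.
    by rewrite -gmulfR -gmulfXn; apply/fP/lower_p_series_expg/IH.
  apply/commute_sym/commgP/eqP; rewrite -!gmulfR; apply/fP/lower_p_series_commg.
  exact: IH.
- exact/lower_p_series_commg/IH.
Qed.

(* [z, y] is central modulo P i.+3, and so is killed by the exponent p (p - 1) / 2
   of the class 2 formula: by [p] if p is odd, and by powerfulness if p = 2. *)
Lemma expgMp_lower_p_series i y z : P i.+1 z ->
  exists2 w, P i.+3 w & (y * z) ^+ p = y ^+ p * z ^+ p * w.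
Proof.
move=> Pz; have [Q [f [_ fP]]] := lower_p_series_quotient i.+2.
exists ((y ^+ p * z ^+ p)^-1 * (y * z) ^+ p); last by rewrite mulVKg.
have cz : commute (f z) (f [~ z, y]) /\ commute (f y) (f [~ z, y]).
  by split; apply/commute_sym/commgP/eqP; rewrite -gmulfR;
    apply/fP/lower_p_series_commg/lower_p_series_commg.
apply/fP; rewrite gmulfM gmulfV gmulfXn !gmulfM expgMn_class2 -?gmulfR; try by case: cz.
rewrite -!gmulfXn -!gmulfM -gmulfV -gmulfM mulKg; apply/fP.
have [p2|p_odd] := eqVneq p 2%N.
  apply: (subgroupX _ (lower_p_series_subgroup _)) => //.
  exact: lower_2_series_commg.
have /dvdnP[q ->] : p %| 'C(p, 2).
  apply: prime_dvd_bin => //=.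
  by have := prime_gt1 p_pr; rewrite leq_eqVlt eq_sym (negPf p_odd).
rewrite mulnC expgnA; apply: (subgroupX _ (lower_p_series_subgroup _)).
exact/lower_p_series_expg/lower_p_series_commg.
Qed.

(** The actual p-th powers, not the subgroup they generate: this is what makes the power map between
    layers surjective once the set is shown to contain [P i.+2]. *)
Definition pth_powers_mod i : set U :=
  set_prod [set x ^+ p | x in P i.+1] (P i.+3).

(** By [expgMp_lower_p_series], the p-th power map is multiplicative on [P i.+1] modulo [P i.+3]. *)
Lemma pth_powers_mod_subgroup i : is_subgroup (pth_powers_mod i).
Proof.
have [sP nP _] := lower_p_seriesP i.+2; apply: subgroup_intro.
- exists 1; first by exists 1; [exact: subgroup1 | rewrite expg1n].
  by exists 1; [exact: subgroup1 | rewrite mulg1].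
- move=> _ _ [_ [x Px <-] [v Pv <-]] [_ [y Py <-] [w Pw <-]].
  have [u Pu xy] := expgMp_lower_p_series x Py.
  exists ((x * y) ^+ p); first by exists (x * y) => //; apply: subgroupM.
  exists (u^-1 * v ^ (y ^+ p) * w).
    apply: (subgroupM sP) => //.
    by apply: (subgroupM sP); [exact: (subgroupV sP) | exact: nP].
  move: (conjgC v (y ^+ p)); move: (v ^ _) => t vyt.
  by rewrite xy -!mulgA mulVKg (mulgA _ t) -vyt -mulgA.
- move=> _ [_ [x Px <-] [v Pv <-]].
  exists (x^-1 ^+ p); first by exists x^-1 => //; apply: subgroupV.
  exists (v^-1 ^ (x^-1 ^+ p)); first by apply/nP/(subgroupV sP).
  by rewrite -conjgC expVgn invgM.
Qed.

Lemma pth_powers_mod_normal i : is_normal (pth_powers_mod i).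
Proof.
apply: normal_set_prod; last exact: lower_p_series_normal.
move=> _ y [x Px <-]; exists (x ^ y); last by rewrite conjXg.
exact: lower_p_series_normal.
Qed.

Hypotheses (U_compact : compact [set: U]) (U_hausdorff : hausdorff_space U).

Lemma lower_p_series_compact i : compact (P i.+1).
Proof. exact: subclosed_compact (@lower_p_series_closed i) U_compact _. Qed.

Lemma pth_powers_mod_closed i : closed (pth_powers_mod i).
Proof.
apply: (compact_closed U_hausdorff); apply: compact_set_prod.
  apply: continuous_compact; last exact: lower_p_series_compact.
  apply: continuous_subspaceT; apply: continuous_expg => x; exact: cvg_id.
exact: lower_p_series_compact.
Qed.

(** Commutators have to be p-th powers modulo [P i.+3]. In the first layer this is powerfulness.
    Afterwards an element of the layer is [a ^+ p * w] by induction, and [[~ a ^+ p, y]] is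
    [[~ a, y] ^+ p] up to a term two layers below [[~ a, y]]. *)
Lemma lower_p_series_pth_powers i : P i.+2 `<=` pth_powers_mod i.
Proof.
have sV := pth_powers_mod_subgroup; have nV := pth_powers_mod_normal.
have Vexp j x : P j.+1 x -> pth_powers_mod j (x ^+ p).
  move=> Px; exists (x ^+ p); first by exists x.
  by exists 1; [exact: subgroup1 | rewrite mulg1].
have Vsub j x : P j.+3 x -> pth_powers_mod j x.
  move=> Px; exists 1; last by exists x; rewrite ?mul1g.
  by exists 1; [exact: subgroup1 | rewrite expg1n].
elim: i => [|i IH]; apply: lower_p_series_min => //;
  try exact: pth_powers_mod_closed; try exact: Vexp.
  move=> x y _; have := @powerful_commg x y; case: eqP => [p2|_].
    by move=> _; apply/Vsub/lower_2_series_commg.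
  have sub : closure (power_subgroup p [set: U]) `<=` pth_powers_mod 0.
    apply: closure_min; first exact: pth_powers_mod_closed.
    by apply: generated_sub => // _ [z _ <-]; apply: Vexp.
  exact: sub.
move=> x y /IH[_ [a Pa <-] [w Pw <-]].
have -> : [~ a ^+ p * w, y] = [~ a ^+ p, y] ^ w * [~ w, y].
  by rewrite /commg /conjg !invgM !mulgA !(mulgK, mulgVK).
apply: subgroupM => //; last exact/Vsub/lower_p_series_commg.
apply: nV; rewrite commgEl conjXg.
have -> : a ^ y = a * [~ a, y] by rewrite commgEl mulVKg.
have Pay := @lower_p_series_commg _ _ y Pa.
have [v Pv ->] := @expgMp_lower_p_series _ a _ Pay.
rewrite -mulgA mulKg; apply: subgroupM => //; [exact: Vexp | exact: Vsub].
Qed.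

End LowerPSeries.

(** * Uniqueness of roots in uniform groups *)

Section UniformGroups.
Variables (p : nat) (U : topologicalGroupType).
Local Notation P := (@lower_p_series p U).
Implicit Types x y z : U.
Hypothesis p_pr : prime p.
Hypothesis U_uniform : uniform_pro_p_group p U.

Let U_compact : compact [set: U].
Proof. by case: U_uniform => -[[]]. Qed.

Let U_hausdorff : hausdorff_space U.
Proof. by case: U_uniform => -[[]]. Qed.

Let U_powerful : powerful p U.
Proof. by case: U_uniform. Qed.

(* K contains P_2(U), hence is normal and contains x ^+ p: so the p translates of K
   by powers of x form a subgroup. *)
Let adjoin (K : set U) x : is_subgroup K -> closed K -> P 2 `<=` K ->
  finite_index K (P 2) ->
  exists K', [/\ is_subgroup K', closed K', K `<=` K', K' x & finite_index K' (P 2)].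
Proof.
move=> sK cK PK fK; have nK : is_normal K.
  move=> k u Kk; rewrite -(mulVKg k (k ^ u)) -commgEl; apply: subgroupM => //.
  by apply: PK; apply: (@lower_p_series_commg p U 0).
have KX y : K (y ^+ p) by apply: PK; apply: (@lower_p_series_expg p U 0).
pose K' := set_prod [set x ^+ a | a in `I_p] K.
(* Exponents are reduced modulo p, the multiple of p being absorbed into [K]. *)
have K'I a k : K k -> K' (x ^+ a * k).
  move=> Kk; exists (x ^+ (a %% p)).
    by exists (a %% p)%N => //=; rewrite ltn_mod prime_gt0.
  exists (x ^+ p ^+ (a %/ p) * k).
    exact: (subgroupM sK (subgroupX _ sK (KX x)) Kk).
  by rewrite mulgA -expgnA -expgnDr addnC mulnC -divn_eq.
exists K'; split.
- apply: subgroup_intro.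
  + by have := K'I 0%N _ (subgroup1 sK); rewrite mulg1.
  + move=> _ _ [_ [a _ <-] [k Kk <-]] [_ [b _ <-] [l Kl <-]].
    have := K'I (a + b)%N (k ^ (x ^+ b) * l) (subgroupM sK (nK _ _ Kk) Kl).
    move: (conjgC k (x ^+ b)); move: (k ^ _) => t kxt.
    by rewrite expgnDr -!mulgA (mulgA _ t) -kxt -mulgA.
  + move=> _ [_ [a _ <-] [k Kk <-]].
    have Kt := nK _ (x ^- a) (subgroupV sK Kk).
    (* Negative powers are avoided: the inverse of [x ^+ a] is [x ^+ (a * p.-1)] times the inverse
       of [x ^+ a ^+ p], and the latter lies in [K]. *)
    have := K'I (a * p.-1)%N _ (subgroupM sK (subgroupV sK (KX (x ^+ a))) Kt).
    rewrite mulgA expgnA -[X in x ^+ a ^- X](prednK (prime_gt0 p_pr)) expgS invgM.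
    by rewrite mulVKg -conjgC -invgM.
- apply: (compact_closed U_hausdorff); apply: compact_set_prod.
    apply: finite_compact; exact/finite_image/finite_II.
  exact: subclosed_compact cK U_compact _.
- by move=> k Kk; have := K'I 0%N k Kk; rewrite mul1g.
- by have := K'I 1%N _ (subgroup1 sK); rewrite mulg1.
- have : finite_set ((fun aC : nat * set U => [set x ^+ aC.1 * z | z in aC.2]) @`
      (`I_p `*` left_cosets K (P 2))).
    by apply/finite_image/finite_setX => //; apply: finite_II.
  apply: sub_finite_set => _ [_ [_ [a pa <-] [k Kk <-]] <-].
  exists (a, left_coset k (P 2)); first by split=> //; exists k.
  rewrite eqEsubset; split=> [_ [_ [z Pz <-] <-]|_ [z Pz <-]].
    by exists z => //; rewrite mulgA.
  by exists (k * z); [exists z | rewrite mulgA].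
Qed.

(** Starting from [P 2], the finitely many topological generators are adjoined one at a time. The
    resulting closed subgroup contains all of them, hence is the whole group, and each step
    preserves finite index. *)
Lemma frattini_quotient_finite : finite_set (left_cosets [set: U] (P 2)).
Proof.
have [_ [S fS genS] _ _] := U_uniform.
have [sP nP cP] := @lower_p_seriesP p U 1.
have [s Ss] := (finite_seqP S).1 fS.
have [K [sK cK PK SK fK]] : exists K, [/\ is_subgroup K, closed K, P 2 `<=` K,
    [set` s] `<=` K & finite_index K (P 2)].
  elim: s {Ss} => [|x s [K [sK cK PK SK fK]]].
    exists (P 2); split=> //; apply: (@sub_finite_set _ _ [set P 2]).
      move=> _ [x Px <-] /=; transitivity (left_coset 1 (P 2)).
        by apply/left_coset_eq => //; rewrite mulg1; apply: (subgroupV sP).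
      rewrite eqEsubset; split=> [_ [z Pz <-]|z Pz]; first by rewrite mul1g.
      by exists z; rewrite ?mul1g.
    exact: finite_set1.
  have [K' [sK' cK' KK' K'x fK']] := @adjoin K x sK cK PK fK.
  exists K'; split=> // [y /PK /KK'//|y /=].
  by rewrite inE => /predU1P[->|/SK /KK'].
suff -> : [set: U] = K by [].
rewrite eqEsubset; split=> // x _.
have : closure (generated S) `<=` K.
  by apply: closure_min => //; apply: generated_sub => //; rewrite Ss.
by apply; rewrite genS.
Qed.

(* The p-th power map induces a surjection between consecutive layers P_i / P_(i+1),
   which are finite of the same size: hence it is injective. *)
Lemma lower_p_series_root i z : P i.+1 z -> P i.+3 (z ^+ p) -> P i.+2 z.
Proof.
move=> Pz Pzp; have [_ _ _ cP] := U_uniform.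
have [sP2 _ _] := @lower_p_seriesP p U i.+1.
have [sP3 _ _] := @lower_p_seriesP p U i.+2.
pose A := left_cosets (P i.+1) (P i.+2); pose B := left_cosets (P i.+2) (P i.+3).
have AB : A #= B by apply: card_eq_trans (cP i.+1 _) (card_esym (cP i.+2 _)).
have fA : finite_set A.
  have /card_eqPle[le _] := cP i.+1 isT.
  exact: card_le_finite le frattini_quotient_finite.
(* The p-th power map on cosets, through a chosen representative. The default 1 is never reached
   since cosets are nonempty, and [gE] shows independence of the choice. *)
pose g (C : set U) := left_coset (xget 1 C ^+ p) (P i.+3).
have gE x : g (left_coset x (P i.+2)) = left_coset (x ^+ p) (P i.+3).
  have : left_coset x (P i.+2) x by exists 1; [exact: subgroup1 | rewrite mulg1].
  rewrite /g => /(xgetI 1); move: (xget _ _) => _ [w Pw <-].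
  have [v Pv ->] := @expgMp_lower_p_series p U p_pr U_powerful i.+1 x w Pw.
  apply/esym/(left_coset_eq _ _ sP3); rewrite -!mulgA mulKg.
  apply: (subgroupM sP3); first exact: lower_p_series_expg.
  exact: lower_p_series_sub.
have gAB : g @` A = B.
  rewrite eqEsubset; split=> [_ [_ [x Px <-] <-]|_ [x Px <-]].
    by rewrite gE; exists (x ^+ p) => //; apply: lower_p_series_expg.
  have [_ [a Pa <-] [w Pw <-]] :=
    @lower_p_series_pth_powers p U p_pr U_powerful U_compact U_hausdorff i x Px.
  exists (left_coset a (P i.+2)); first by exists a.
  by rewrite gE; apply/(left_coset_eq _ _ sP3); rewrite mulKg.
have sP1 := @lower_p_series_subgroup p U i.
(* The cosets of 1 and of [z] have the same image under the injective map [g]. *)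
have /(left_coset_eq _ _ sP2) : left_coset 1 (P i.+2) = left_coset z (P i.+2).
  apply: (surj_card_eq_inj fA AB gAB).
  - by apply/mem_set; exists 1 => //; apply: subgroup1.
  - by apply/mem_set; exists z.
  - by rewrite !gE; apply/(left_coset_eq _ _ sP3); rewrite expg1n invg1 mul1g.
by rewrite invg1 mul1g.
Qed.

(** The kernels of finite p-quotients form a neighbourhood basis of 1, so identities can be tested
    in finite p-groups. *)
Lemma open_normal_quotient (V : set U) : nbhs 1 V ->
  exists (Q : finGroupType) (f : {hom U -> Q}), [/\ open (f @^-1` [set 1]),
    f @^-1` [set 1] `<=` V & exists k, #|Q| = (p ^ k)%N].
Proof.
have [[[_ _ base] idx] _ _ _] := U_uniform => /base[H [sH oH HV]].
have [N [sN nN oN NH]] := open_normal_core U_compact sH oH.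
have [k cN] := idx N sN nN oN.
have [Q [f [fN oQ]]] := finite_quotient_group sN nN cN.
exists Q, f; have <- : N = f @^-1` [set 1] by rewrite eqEsubset; split=> x /fN.
by split; [| exact: subset_trans NH HV | exists k].
Qed.

(** Descent on the order of a normal subgroup [K] of [Q] containing the image of a term of the
    series: the next term maps into the smaller subgroup given by [pgroup_chief_step]. *)
Lemma lower_p_series_sub_open (Q : finGroupType) (f : {hom U -> Q}) k :
  open (f @^-1` [set 1]) -> #|Q| = (p ^ k)%N -> exists i, P i.+1 `<=` f @^-1` [set 1].
Proof.
move=> oN oQ.
have pQ : p.-group [set: Q]%G by rewrite /pgroup cardsT oQ pnatX pnat_id.
(* Preimages of subgroups of [Q] contain the open kernel, so they are open and hence closed, as
   [lower_p_series_min] requires. *)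
have cf (K : {group Q}) : is_subgroup [set x | f x \in K] /\ closed [set x | f x \in K].
  have sfK : is_subgroup [set x | f x \in K].
    apply: subgroup_intro => [|x y Kx Ky|x Kx] /=.
    - by rewrite gmulf1 group1.
    - by rewrite gmulfM groupM.
    - by rewrite gmulfV groupV.
  split=> //; apply: open_subgroup_closed => //; apply: subgroup_nbhs_open => //.
  have : f @^-1` [set 1] `<=` [set x | f x \in K] by move=> x /= ->; apply: group1.
  by move/filterS; apply; apply: open_nbhs_nbhs; split=> //=; rewrite gmulf1.
suff H (n : nat) : forall (K : {group Q}) i, (#|K| <= n)%N -> K <| [set: Q]%G ->
    P i.+1 `<=` [set x | f x \in K] -> exists i, P i.+1 `<=` f @^-1` [set 1].
  apply: (H _ [set: Q]%G 0%N (leqnn _) (normal_refl _)) => x _ /=.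
  by rewrite finset.in_setT.
elim: n => [|n IH] K i; first by rewrite leqNgt cardG_gt0.
move=> Kn nK PK; have [K1|K1] := eqVneq (K :> {set Q}) 1.
  by exists i => x /PK /=; rewrite K1 => /set1P.
have [L [nL LK LX LR]] := pgroup_chief_step pQ nK K1.
apply: (IH L i.+1) => //; first by rewrite -ltnS (leq_trans LK).
have [sL cL] := cf L.
apply: lower_p_series_min => // [x /PK Kx|x y /PK Kx] /=.
  by rewrite gmulfXn; apply: LX.
by rewrite gmulfR; apply: LR; rewrite ?finset.in_setT.
Qed.

Lemma nbhs1_eq1 x : (forall V : set U, nbhs 1 V -> V x) -> x = 1.
Proof.
move=> Vx; apply: U_hausdorff => A B nA nB; exists x; split.
  exact: nbhs_singleton.
exact: Vx.
Qed.

Lemma uniform_unique_p_root x y : x ^+ p = y ^+ p -> x = y.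
Proof.
move=> xy; pose z := y^-1 * x.
have Pz i : P i.+1 z.
  elim: i => [//|i Pz]; apply: lower_p_series_root => //.
  (* Since [x] is [y * z], comparing p-th powers leaves [z ^+ p * w = 1] with [w] in [P i.+3];
     [lower_p_series_root] then pushes [z] one layer down. *)
  have [w Pw] := @expgMp_lower_p_series p U p_pr U_powerful i y z Pz.
  rewrite mulVKg xy -mulgA => /esym; rewrite -[RHS]mulg1 => /mulgI zw.
  have -> : z ^+ p = w^-1 by apply: (@mulIg _ w); rewrite zw mulVg.
  exact: (subgroupV (@lower_p_series_subgroup p U i.+2)).
suff z1 : z = 1 by rewrite -(mulVKg y x) -/z z1 mulg1.
apply: nbhs1_eq1 => V /open_normal_quotient[Q [f [oN NV [k oQ]]]].
by have [i PN] := lower_p_series_sub_open oN oQ; apply/NV/PN.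
Qed.

(** In a finite group of order prime to n, taking n-th powers is injective; this is applied in every
    finite p-quotient. *)
Lemma uniform_unique_coprime_root n x y : coprime n p -> x ^+ n = y ^+ n -> x = y.
Proof.
move=> np xy; suff z1 : y^-1 * x = 1 by rewrite -(mulVKg y x) z1 mulg1.
apply: nbhs1_eq1 => V /open_normal_quotient[Q [f [oN NV [k oQ]]]].
apply: NV; rewrite /= gmulfM gmulfV; suff -> : f x = f y by rewrite mulVg.
have coQ : coprime #|[set: Q]%G| n by rewrite cardsT oQ coprimeXl // coprime_sym.
rewrite -(expgK coQ (finset.in_setT (f x))) -(expgK coQ (finset.in_setT (f y))).
by rewrite /= -!gmulfXn xy.
Qed.

Lemma uniform_unique_roots : unique_roots U.
Proof.
move=> n x y n0.
(* Write n as [m] times a power of p with [m] prime to p, and strip the factors p one by one. *)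
have [m pm] := pfactor_coprime p_pr n0; move: (logn p n) => k ->; rewrite mulnC.
elim: k x y => [|k IH] x y.
  by rewrite mul1n; apply: uniform_unique_coprime_root; rewrite coprime_sym.
rewrite expnS -mulnA [(p * _)%N]mulnC !(expgnA _ _ p) => /uniform_unique_p_root.
exact: IH.
Qed.

End UniformGroups.

Theorem theorem2p5 (p c : nat) (U : topologicalGroupType) (G : set U) :
  prime p ->
  uniform_pro_p_group p U ->
  is_subgroup G ->
  (exists H : set U,
     [/\ is_subgroup H, H `<=` G, finite_index G H &
         nilpotent_of_class_le c H]) ->
  nilpotent_of_class_le c G.
Proof.
move=> p_pr Uunif sG [H [sH HG fGH nilH]].
(* [S] is [G] as a group in its own right. Unique roots pass to it from [U] through the injection
   [f], with no closedness of [G] involved. *)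
have [S [f [f_inj fG]]] := subgroup_group sG.
have fH : f @` (f @^-1` H) = H.
  rewrite eqEsubset; split=> [_ [x Hx <-] //|x Hx].
  by have := HG x Hx; rewrite -fG => -[s _ sx]; exists s; rewrite /= ?sx.
rewrite -fG; apply/(image_nilpotent _ _ f_inj).
apply: (@nilpotent_of_finite_exponent_subgroup c S (f @^-1` H)).
- move=> n x y n0 xy; apply/f_inj/(uniform_unique_roots p_pr Uunif n0).
  by rewrite -!gmulfXn xy.
- exact: subgroup_preimage.
- move=> x; have Gfx : G (f x) by rewrite -fG; exists x.
  have [n n0 Hn] := finite_index_power sH sG fGH Gfx.
  by exists n => //=; rewrite gmulfXn.
- by apply/(image_nilpotent _ _ f_inj); rewrite fH.
Qed.
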